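(* For every integer $r\ge 1$ there is a bound $g(r)$ such that the following holds. Let $G$ be a finite soluble group of rank $r$. Then $G/F(G)$ has an abelian normal subgroup $A$ with $|A|\le |F(G)/\Phi(G)|$ and $|(G/F(G)):A|\le g(r)$, and, moreover, if $G$ has no section $\mathrm{Aff}(E,C)$ of affine cyclic type with $|C|>T$ (for a given $T>0$), then $|A|\le (T!)^r$.
   Context: The rank of a finite group is the minimal $r$ such that every subgroup is $r$-generated. $F(G)$ denotes the Fitting subgroup (largest nilpotent normal subgroup) and $\Phi(G)$ the Frattini subgroup of $G$. A section of $G$ is a quotient of a subgroup of $G$. A group of affine cyclic type $\mathrm{Aff}(E,C)$ is a finite group $E\rtimes C$ where $E$ is an elementary abelian $p$-group and $C$ is a cyclic group of prime power order acting faithfully on $E$, with $p\nmid |C|$. *)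

(* Defs.v *)
From mathcomp Require Import all_boot all_order all_fingroup all_solvable.
Set Implicit Arguments. Unset Strict Implicit. Unset Printing Implicit Defensive.
Local Open Scope group_scope.

Definition r_generated (gT : finGroupType) (H : {set gT}) (r : nat) : Prop :=
  exists X : {set gT}, (#|X| <= r)%N /\ <<X>> = H.

Definition has_rank (gT : finGroupType) (G : {group gT}) (r : nat) : Prop :=
  (forall H : {group gT}, H \subset G -> r_generated H r) /\
  (forall s : nat, (forall H : {group gT}, H \subset G -> r_generated H s) -> (r <= s)%N).

Definition affine_cyclic_type (gT : finGroupType) (X : {set gT}) (c : nat) : Prop :=
  exists (p q : nat) (E C : {group gT}),
    [/\ [/\ prime p, p.-abelem E & E ><| C = X],
        [/\ prime q, q.-group C & cyclic C],
        'C_C(E) = 1, ~~ (p %| #|C|)%N & #|C| = c].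

Definition has_aff_section_gt (gT : finGroupType) (G : {group gT}) (T : nat) : Prop :=
  exists (H K : {group gT}), [/\ H \subset G, K <| H &
    exists c : nat, (T < c)%N /\ affine_cyclic_type (H / K) c].

(* Main.v *)
Require Import Defs.
From mathcomp Require Import all_boot all_order all_fingroup all_algebra.
From mathcomp Require Import all_solvable all_field all_character.
Set Implicit Arguments. Unset Strict Implicit. Unset Printing Implicit Defensive.
Local Open Scope group_scope.

(** Modulo ['Phi(G)] we may assume ['Phi(G) = 1].  Then ['F(G)] is the direct
product of the elementary abelian groups [P = 'O_p(G)], the intersection of
their centralisers is ['F(G)], and [G / 'C_G(P)] has no nontrivial normal
[p]-subgroup because normal subgroups contained in [P] are complemented in
[G].  By a theorem of Mal'cev, [G / 'C_G(P)], a soluble linear group of degree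
at most [r], has an abelian normal subgroup of index bounded by some [m]
depending on [r] only.  Take for [A] the intersection of all normal subgroups
of index at most [m] containing ['F(G)]: it is abelian modulo every ['C_G(P)],
hence modulo ['F(G)], and its index is bounded since [G] has rank at most [r].
Modulo ['C_G(P)], [A] is an abelian [p']-group, so it has a regular orbit on
[P]; multiplying over [p] gives the bound by [#|'F(G)|].  Finally a cyclic
[q]-subgroup of [A / 'C_A(P)] acts faithfully on [P], which yields a section
of affine cyclic type: without such sections of order above [T], the exponent
of [A] modulo ['F(G)] divides [T`!]. *)

(** * Groups of bounded rank *)

(** The upper-bound half of [has_rank]: it passes to subgroups and quotients, whereas the exact rank
    may drop. *)
Definition rank_le (gT : finGroupType) (G : {group gT}) (r : nat) : Prop :=
  forall H : {group gT}, H \subset G -> r_generated H r.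

Lemma rank_leS r (gT : finGroupType) (G H : {group gT}) :
  H \subset G -> rank_le G r -> rank_le H r.
Proof. by move=> sHG rkG L sLH; apply/rkG/(subset_trans sLH). Qed.

Lemma r_generated_morphim r (aT rT : finGroupType) (D G : {group aT})
    (f : {morphism D >-> rT}) :
  G \subset D -> r_generated G r -> r_generated (f @* G) r.
Proof.
move=> sGD [X [leX genX]]; exists (f @* X); split.
  by apply: leq_trans leX;
    apply: leq_trans (leq_imset_card _ _) (subset_leq_card (subsetIr _ _)).
by rewrite -morphim_gen ?genX // (subset_trans _ sGD) // -genX subset_gen.
Qed.

Lemma rank_le_quotient r (gT : finGroupType) (G N : {group gT}) :
  N <| G -> rank_le G r -> rank_le (G / N) r.
Proof.
move=> nNG rkG L /(inv_quotientS nNG)[H -> _ sHG].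
by apply: r_generated_morphim (rkG H sHG);
  rewrite (subset_trans sHG) ?normal_norm.
Qed.

(** [A] is a direct product of ['r(A)] cyclic groups of order dividing [e], and ['r(A)] is its least
    number of generators. *)
Lemma card_abelian_le r e (gT : finGroupType) (A : {group gT}) :
  abelian A -> r_generated A r -> (0 < e)%N -> exponent A %| e ->
  (#|A| <= e ^ r)%N.
Proof.
move=> abA [X [leX genX]] e0 expA.
have rA : ('r(A) <= r)%N.
  by rewrite -(grank_abelian abA) -genX (leq_trans (grank_min _)).
have [b defA tyA] := abelian_structure abA.
have szb : size b = 'r(A) by rewrite -(size_abelian_type abA) -tyA size_map.
have sbA : all [pred x | x \in A] b.
  apply/allP=> x xb /=; rewrite -cycle_subG -(bigdprodWY defA).
  by rewrite (big_rem x xb) /= sub_gen // subsetUl.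
rewrite -(bigdprod_card defA).
apply: (@leq_trans (e ^ size b)); last first.
  by rewrite szb; case: (e) e0 => // e' _; rewrite leq_pexp2l.
elim: (b) sbA => [|x s IHs] /=; first by rewrite big_nil.
case/andP=> Ax /IHs le_s; rewrite big_cons expnS leq_mul //.
by rewrite dvdn_leq // (dvdn_trans (dvdn_exponent Ax)).
Qed.

(** Each of the [d] factors of the derived series is abelian, so has order at most [e ^ r]. *)
Lemma card_solvable_le r e d (gT : finGroupType) (G : {group gT}) :
  rank_le G r -> (0 < e)%N -> exponent G %| e -> G^`(d) = 1 ->
  (#|G| <= (e ^ r) ^ d)%N.
Proof.
move=> rkG e0 expG dG1; rewrite -(indexg1 G) -dG1.
elim: d {dG1} => [|d IHd]; first by rewrite derg0 indexgg.
rewrite -(Lagrange_index (der_sub d G) (der_subS d G)) expnSr leq_mul //.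
have nsd := der_normalS d G.
rewrite -card_quotient ?normal_norm //; apply: card_abelian_le => //.
- exact: der_abelian.
- apply: r_generated_morphim; rewrite ?normal_norm //.
  exact/rkG/der_sub.
- by rewrite (dvdn_trans (exponent_quotient _ _)) // (dvdn_trans _ expG) //
  exponentS ?der_sub.
Qed.

(** Until it reaches 1, the derived series loses at least one element at each step. *)
Lemma der_card_trivial (gT : finGroupType) (G : {group gT}) m :
  solvable G -> (#|G| <= m)%N -> G^`(m) = 1.
Proof.
move=> solG leGm.
have claim i : G^`(i) = 1 \/ (#|G^`(i)| + i <= #|G|)%N.
  elim: i => [|i [d1|le_i]]; first by right; rewrite derg0 addn0.
    by left; apply/trivgP; rewrite -d1 der_subS.
  have [d1|nd1] := eqVneq G^`(i) 1.
    by left; apply/trivgP; rewrite -d1 der_subS.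
  right; apply: leq_trans le_i; rewrite addnS ltn_add2r proper_card //.
  by rewrite (dergSn i) (sol_der1_proper solG) ?der_sub.
case: (claim m) => // le_m; have := leq_trans le_m leGm.
by rewrite -[X in (_ <= X)%N]add0n leq_add2r leqNgt cardG_gt0.
Qed.

(* The intersection bounds both the exponent and the derived length of the
   quotient, whatever the number of subgroups intersected. *)
Lemma index_bigcap_le r m (gT : finGroupType) (G : {group gT})
    (P : pred {group gT}) :
    solvable G -> rank_le G r ->
    (forall B, P B -> B <| G /\ #|G : B| <= m)%N ->
  (#|G : \bigcap_(B : {group gT} | P B) B| <= (m`! ^ r) ^ m)%N.
Proof.
move=> solG rkG PB; pose I := (\bigcap_(B : {group gT} | P B) B)%G.
change (#|G : I| <= (m`! ^ r) ^ m)%N; rewrite -indexgI.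
have nsI : G :&: I <| G.
  rewrite /normal subsetIl normsI ?normG //=.
  by apply: norms_bigcap; apply/bigcapsP=> B /PB[/normal_norm].
rewrite -card_quotient ?normal_norm //; apply: card_solvable_le.
- exact: rank_le_quotient.
- exact: fact_gt0.
- apply/exponentP=> xb /morphimP[x nIx Gx ->]; rewrite -morphX //=;
  apply: coset_id.
  rewrite inE groupX //=; apply/bigcapP=> B /PB[nsB leB].
  have nBx : x \in 'N(B) by apply: (subsetP (normal_norm nsB)).
  apply: coset_idr; rewrite ?groupX // morphX //; apply/eqP;
    rewrite -order_dvdn.
  apply: dvdn_trans (order_dvdG (mem_quotient B Gx)) _.
  by rewrite card_quotient ?normal_norm // dvdn_fact // leB andbT indexg_gt0.
- rewrite -quotient_der ?normal_norm //; apply/trivgP.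
  rewrite quotient_sub1;
    last by rewrite (subset_trans (der_sub m G)) ?normal_norm.
  rewrite subsetI (der_sub m G) /=; apply/bigcapsP=> B /PB[nsB leB].
  rewrite -quotient_sub1;
    last by rewrite (subset_trans (der_sub m G)) ?normal_norm.
  rewrite quotient_der ?normal_norm // der_card_trivial ?quotient_sol //.
  by rewrite card_quotient ?normal_norm.
Qed.

(** * Abelian linear groups *)

Section LinearGroups.

Import GRing.Theory.
Local Open Scope ring_scope.

Lemma char_poly_similar (R : comNzRingType) n (P Q A : 'M[R]_n) :
  Q *m P = 1%:M -> char_poly (P *m A *m Q) = char_poly A.
Proof.
move=> QP1; have PQ1 := mulmx1C QP1.
rewrite /char_poly; set f := @polyC R.
have -> : char_poly_mx (P *m A *m Q) =
      map_mx f P *m char_poly_mx A *m map_mx f Q.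
  rewrite /char_poly_mx !map_mxM mulmxBr mulmxBl; congr (_ - _).
  by rewrite mul_mx_scalar -scalemxAl -map_mxM PQ1 map_mx1 scalemx1.
by rewrite !det_mulmx mulrAC -det_mulmx -map_mxM PQ1 map_mx1 det1 mul1r.
Qed.

(* Over an algebraic closure the matrices become simultaneously diagonal, with
   diagonal entries among the roots of the common characteristic polynomial. *)
Lemma size_commuting_similar (F : finFieldType) n m q (As : seq 'M[F]_n.+1) :
    m%:R != 0 :> F -> uniq As -> {in As &, forall A B, comm_mx A B} ->
    {in As, forall A, A ^+ m = 1} -> {in As, forall A, char_poly A = q} ->
  (size As <= n.+1 ^ n.+1)%N.
Proof.
move=> m0 uAs cAs expA chA.
case Es: As => [//|A1 As1]; rewrite -Es.
have A1in : A1 \in As by rewrite Es mem_head.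
have [K [f _]] := countable_algebraic_closure F.
pose Bs := map (map_mx f) As.
have [rs Drs] := closed_field_poly_normal ('X^m - 1 : {poly K}).
have [s Ds] := closed_field_poly_normal (map_poly f q).
have mK0 : m%:R != 0 :> K by rewrite -(rmorph_nat f) fmorph_eq0.
have m_gt0 : (0 < m)%N by case: (m) m0; rewrite ?eqxx.
rewrite (monicP (monic_Xn_sub_1 _ m_gt0)) scale1r in Drs.
have u_rs : uniq rs by rewrite -separable_prod_XsubC -Drs separable_Xn_sub_1.
have mon_q : map_poly f q \is monic
  by rewrite map_monic -(chA A1) // char_poly_monic.
rewrite (monicP mon_q) scale1r in Ds.
have size_s : size s = n.+1.
  apply/eqP; rewrite -eqSS -(size_prod_XsubC s id) -Ds size_map_poly.
  by rewrite -(chA A1) // size_char_poly.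
have [P Pu /allP dP] : exists2 P : 'M[K]_n.+1, P \in unitmx
    & all [pred A | mxred.similar_diag P A] Bs.
  apply/codiagonalizableP; split.
    by move=> _ _ /mapP[A Ain ->] /mapP[B Bin ->];
      rewrite /comm_mx -!map_mxM (cAs A B).
  (* The minimal polynomial divides ['X^m - 1], whose roots are distinct as [m] is nonzero in
     [F]. *)
  move=> _ /mapP[A Ain ->]; apply/diagonalizableP; exists rs => //.
  rewrite -Drs; apply: mxminpoly_min;
    rewrite rmorphB /= rmorphXn /= horner_mx_X.
  by rewrite rmorph1 -rmorphXn /= expA // rmorph1 subrr.
pose d (A : 'M[F]_n.+1) i := (P *m map_mx f A *m invmx P) i i.
have dE A : A \in As -> P *m map_mx f A = diag_mx (\row_i d A i) *m P.
  move=> Ain; have := dP _ (map_f (map_mx f) Ain); rewrite inE.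
  case/similar_diagPex=> D /(similarP Pu) PA; rewrite PA;
    congr (diag_mx _ *m _).
  apply/rowP=> i; rewrite !mxE /d PA mulmxK // !mxE eqxx.
  by rewrite mulr1n.
have d_s A i : A \in As -> d A i \in s.
  move=> Ain; rewrite -root_prod_XsubC -Ds -(chA A Ain) map_char_poly.
  rewrite -eigenvalue_root_char; apply/eigenvalueP; exists (row i P).
    by rewrite -row_mul dE // mul_diag_mx; apply/rowP=> j; rewrite !mxE.
  apply/negP; rewrite rowE => /eqP/(congr1 (mulmxr (invmx P))) /=.
  rewrite mulmxK // mul0mx => /matrixP/(_ 0 i)/eqP.
  by rewrite !mxE !eqxx oner_eq0.
(* [g A] records which root of [q] sits at each diagonal place; [inord] loses nothing, as every
   index is below [size s = n.+1]. *)
pose g A : {ffun 'I_n.+1 -> 'I_n.+1} := [ffun i => inord (index (d A i) s)].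
have g_inj : {in As &, injective g}.
  move=> A B Ain Bin /ffunP eqg; apply: (@map_mx_inj _ _ f).
  apply: (can_inj (mulKmx Pu)); rewrite !dE //; congr (diag_mx _ *m _).
  apply/rowP=> i; rewrite !mxE; have := congr1 val (eqg i).
  rewrite !ffunE /= !inordK -?size_s ?index_mem ?d_s // => eqi.
  by rewrite -(nth_index 0 (d_s A i Ain)) eqi nth_index ?d_s.
rewrite -(size_map g)
  (leq_trans (uniq_leq_size _ (_ : {subset _ <= enum setT}))) //.
- by rewrite map_inj_in_uniq.
- by move=> h _; rewrite mem_enum inE.
- by rewrite -cardE cardsT card_ffun card_ord.
Qed.


(** The conjugates of [x] stay in the abelian group [N], so they act by commuting matrices with one
    characteristic polynomial; faithfulness keeps these distinct. *)
Lemma card_class_repr p n (gT : finGroupType) (G L N : {group gT})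
    (rG : mx_representation 'F_p G n) x :
    prime p -> (0 < n)%N -> mx_faithful rG -> L \subset G -> N \subset G ->
    L \subset 'N(N)%g -> abelian N -> (p^').-group N -> x \in N ->
  (#|x ^: L| <= n ^ n)%N.
Proof.
move=> p_pr; case: n rG => // n rG _ ffG sLG sNG nNL abN p'N Nx.
have sclN : x ^: L \subset N.
  by apply/subsetP=> _ /imsetP[y Ly ->]; rewrite memJ_norm // (subsetP nNL).
have Gx := subsetP sNG x Nx.
rewrite cardE -(size_map rG).
apply: (@size_commuting_similar _ n #|N| (char_poly (rG x))).
- by rewrite natf_neq0_pchar (eq_pnat _ (eq_negn (charf_eq (pchar_Fp p_pr)))).
- rewrite map_inj_in_uniq ?enum_uniq // => y z.
  rewrite !mem_enum => /(subsetP sclN) Ny /(subsetP sclN) Nz.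
  by apply: (mx_faithful_inj ffG); apply: (subsetP sNG).
- move=> _ _ /mapP[y + ->] /mapP[z + ->].
  rewrite !mem_enum => /(subsetP sclN) Ny /(subsetP sclN) Nz.
  rewrite /comm_mx -!repr_mxM ?(subsetP sNG) //.
  by rewrite (centsP abN).
- move=> _ /mapP[y + ->]; rewrite mem_enum => /(subsetP sclN) Ny.
  by rewrite -repr_mxX ?(subsetP sNG) // expg_cardG // repr_mx1.
- move=> _ /mapP[y + ->]; rewrite mem_enum => /imsetP[z Lz ->].
  have Gz := subsetP sLG z Lz.
  rewrite conjgE !repr_mxM ?groupM ?groupV // mulmxA char_poly_similar //.
  by rewrite -repr_mxM ?groupV // mulgV repr_mx1.
Qed.

(* A vector with minimal stabiliser has trivial stabiliser: a vector of a
   complement of the fixed space of that stabiliser could be added to it. *)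
Lemma card_abelian_repr p n (gT : finGroupType) (N : {group gT})
    (rN : mx_representation 'F_p N n) :
    prime p -> mx_faithful rN -> abelian N -> (p^').-group N ->
  (#|N| <= p ^ n)%N.
Proof.
move=> p_pr ffN abN p'N.
have charN : ([pchar 'F_p]^').-group N.
  by rewrite (eq_pgroup _ (eq_negn (charf_eq (pchar_Fp p_pr)))).
have crN := mx_Maschke_pchar rN charN.
pose v := [arg min_(u < (0 : 'rV['F_p]_n)) #|rstab rN u|].
have minv (u : 'rV_n) : (#|rstab rN v| <= #|rstab rN u|)%N.
  rewrite /v; case: arg_minnP => // w _ minw; exact: minw.
have Dv1 : rstab rN v = 1%g.
  pose D := rstab_group rN v.
  have nsD : D <| N by rewrite -sub_abelian_normal // rstab_sub.
  have modD := normal_rfix_mx_module rN nsD.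
  have [U modU sumU dxU] := crN _ modD (submx1 _).
  have vD : (v <= rfix_mx rN D)%MS by rewrite -rfix_mx_rstabC ?rstab_sub.
  have [U0|/rowV0Pn[u Uu nzu]] := eqVneq U 0.
    apply/trivgP; apply: subset_trans ffN.
    rewrite /rker rfix_mx_rstabC ?rstab_sub // -sumU U0.
    by rewrite addsmx_sub submx_refl sub0mx.
  have dx0 (w : 'rV_n) : (w <= rfix_mx rN D)%MS -> (w <= U)%MS -> w = 0.
    move=> Dw Uw; apply/eqP; rewrite -submx0 -(mxdirect_addsP dxU).
    by rewrite sub_capmx Dw.
  have sDvu : rstab rN (v + u) \subset D.
    apply/subsetP=> x; rewrite !inE => /andP[Nx /eqP vux]; rewrite Nx /=.
    (* This vector lies in the fixed space of [D]; being equal to [u - u *m rN x], it also lies in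
       [U]. *)
    have /eqP: v *m rN x - v = 0.
      apply: dx0.
        rewrite addmx_sub ?eqmx_opp //.
        exact: submx_trans (submxMr _ vD) (mxmoduleP modD x Nx).
      have -> : v *m rN x - v = u - u *m rN x.
        by apply/eqP; rewrite subr_eq addrAC eq_sym subr_eq eq_sym addrC
          -mulmxDl vux addrC.
      rewrite addmx_sub ?eqmx_opp //.
      exact: submx_trans (submxMr _ Uu) (mxmoduleP modU x Nx).
    by rewrite subr_eq0.
  have eqD : rstab rN (v + u) = D by apply/eqP; rewrite eqEcard sDvu minv.
  case/eqP: nzu; apply: dx0 => //; rewrite -rfix_mx_rstabC ?rstab_sub //.
  apply/subsetP=> x Dx; have:= Dx; rewrite -{1}eqD => vux.
  have:= rstab_act vux (submx_refl _); rewrite mulmxDl.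
  rewrite (rstab_act Dx (submx_refl _)) => /addrI ux.
  by rewrite inE (subsetP (rstab_sub rN v) _ Dx) ux eqxx.
have orb_inj : {in N &, injective (fun x => v *m rN x)}.
  move=> x y Nx Ny /= eqv; apply/eqP;
    rewrite eq_mulgV1 -in_set1 -[[set 1%g]]Dv1.
  rewrite inE groupM ?groupV //= repr_mxM ?groupV // mulmxA eqv -mulmxA.
  by rewrite -repr_mxM ?groupV // mulgV repr_mx1 mulmx1.
rewrite -(card_in_imset orb_inj) (leq_trans (max_card _)) //.
by rewrite card_mx card_Fp // mul1n.
Qed.
End LinearGroups.

(** * Mal'cev's theorem *)

(** Centralising one more generator multiplies the index by at most the length of an orbit. *)
Lemma index_cent_le (gT : finGroupType) (L : {group gT}) (X : {set gT}) c r :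
    (0 < c)%N -> (#|X| <= r)%N ->
    (forall x, x \in X -> #|x ^: L| <= c)%N ->
  (#|L : 'C_L(<<X>>)| <= c ^ r)%N.
Proof.
move=> c0 leX leXc; rewrite cent_gen.
apply: (@leq_trans (c ^ #|X|));
  last by case: (c) c0 => // c' _; rewrite leq_pexp2l.
rewrite cardE -{1}[X]set_enum.
have: {subset enum X <= X} by move=> x; rewrite mem_enum.
elim: (enum X) => [|x s IHs] sX.
  by rewrite set_nil (setIidPl _) ?indexgg // centsC sub0set.
have Xx : x \in X by rewrite sX ?mem_head.
have {}IHs := IHs (fun y sy => sX y (mem_behead (sy : y \in behead (x :: s)))).
rewrite set_cons centU cent_set1 (setIC 'C[x]) setIA.
have sHL : 'C_L([set:: s]) \subset L by rewrite subsetIl.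
rewrite -(Lagrange_index sHL (subsetIl _ _)) /= expnS mulnC.
rewrite leq_mul // index_cent1.
by apply: leq_trans (leXc x Xx); rewrite subset_leq_card // imsetS.
Qed.

(* Conjugates of [x] have the same [k]-th power, as it lies in the central [N];
   so two of them in the same coset of [N] differ by an element of
   ['Ldiv_k(N)]. *)
Lemma card_class_central_le (gT : finGroupType) (C M N : {group gT}) x r :
    N <| M -> M \subset 'C(N) -> C \subset 'N(M) -> C \subset 'C(N) ->
    rank_le N r -> x \in M ->
  (#|x ^: C| <= #|M : N| * #|M : N| ^ r)%N.
Proof.
move=> nsNM cNM nMC cNC rkN Mx; set k := #|M : N|.
have [sNM nNM] := andP nsNM.
have abN : abelian N := subset_trans sNM cNM.
have Mpow y : y \in M -> y ^+ k \in N.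
  move=> My; have nNy := subsetP nNM y My.
  apply: coset_idr; rewrite ?groupX // morphX //; apply/eqP.
  by rewrite -order_dvdn /k -card_quotient // order_dvdG // mem_quotient.
have sclM y : y \in x ^: C -> y \in M.
  by case/imsetP=> c Cc ->; rewrite memJ_norm // (subsetP nMC).
have clpow y : y \in x ^: C -> y ^+ k = x ^+ k.
  case/imsetP=> c Cc ->; rewrite -conjXg; apply/conjg_fixP/commgP.
  by apply: commute_sym; apply: (centsP cNC) => //; apply: Mpow.
have k_gt0 : (0 < k)%N by apply: indexg_gt0.
pose f y := N :* y.
have fibre t : (#|[set y in x ^: C | f y == t]| <= k ^ r)%N.
  have [->|[y]] := set_0Vmem [set y in x ^: C | f y == t];
    first by rewrite cards0.
  rewrite inE => /andP[Cy /eqP <-].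
  pose Lk := Group (group_Ldiv k abN).
  have leL : (#|Lk| <= k ^ r)%N.
    apply: card_abelian_le => //.
    - exact: (abelianS (subsetIl _ _) abN).
    - by apply: rkN; apply: subsetIl.
    - by rewrite -sub_LdivT subsetIr.
  apply: leq_trans leL;
    rewrite -(card_imset (mem Lk) (mulIg y)) subset_leq_card //.
  apply/subsetP=> z; rewrite inE => /andP[Cz /eqP eqzy].
  have /rcosetP[w Nw Dz] : z \in N :* y by rewrite -[N :* y]eqzy rcoset_refl.
  apply/imsetP; exists w => //; rewrite !inE Nw /=.
  have cwy : commute w y by apply/esym/(centsP cNM) => //; apply: sclM.
  have := clpow z Cz; rewrite Dz expgMn // (clpow y Cy) => /eqP.
  by rewrite eq_sym -{1}[x ^+ k]mul1g (inj_eq (mulIg _)) eq_sym.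
rewrite -sum1_card (partition_big_imset f) /=.
apply: (@leq_trans (\sum_(t in f @: (x ^: C)) k ^ r)).
  apply: leq_sum => t _; apply: leq_trans (fibre t).
  by rewrite -sum1_card; apply/eq_leq/eq_bigl=> y; rewrite !inE.
rewrite sum_nat_const leq_mul // /k -[#|M : N|]/#|rcosets N M|
  subset_leq_card //.
apply/subsetP=> _ /imsetP[y Cy ->]; apply/rcosetsP; exists y => //.
exact: sclM.
Qed.

(** [L / N] is a minimal normal subgroup of [G / N] inside [D / N], elementary abelian by
    solubility. *)
Lemma solvable_normal_layer (gT : finGroupType) (G D N : {group gT}) :
    solvable D -> D <| G -> N <| G -> N \subset D -> ~~ (D \subset N) ->
  exists L : {group gT},
    [/\ L <| G, N \subset L, L \subset D, ~~ (L \subset N) & L^`(1) \subset N].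
Proof.
move=> solD nsDG nsNG sND not_sDN.
have nDN : D \subset 'N(N) := subset_trans (normal_sub nsDG) (normal_norm nsNG).
have nsDN : D / N <| G / N by apply: quotient_normal.
have [Lb minL sLD] : {L : {group coset_of N} |
    minnormal L (G / N) & L \subset D / N}.
  by apply: minnormal_exists; rewrite ?normal_norm // -subG1 quotient_sub1.
have [nLG ntL /is_abelemP[q _ /abelem_abelian abL]] :=
  minnormal_solvable minL sLD (quotient_sol _ solD).
have nsLG : Lb <| G / N.
  by rewrite /normal nLG andbT (subset_trans sLD) ?normal_sub.
have [L defL sNL nsLG1] := inv_quotientN nsNG nsLG.
have nNL := subset_trans (normal_sub nsLG1) (normal_norm nsNG).
exists L; split=> //.
- by rewrite -(quotientSGK nNL sND) -defL.
- by rewrite -quotient_sub1 // -defL subG1.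
- by rewrite der1_min // -defL.
Qed.

(** In the notation of [malcev_faithful], [b] bounds both [#|G : C|] and [#|M : N|], and the second
    factor bounds [#|C : N|]. *)
Definition malcev_bound r :=
  let b := ((r ^ r) ^ r)%N in (b * (b * b ^ r) ^ r)%N.

(* Choose [N] maximal among the abelian normal subgroups and [M / N] maximal
   among the abelian normal subgroups of [G / N] inside ['C_G(N) / N]; then
   ['C_G(M) = N = 'Z(M)], so bounding the number of conjugates of generators
   of [N] and of [M] is enough. *)
Lemma malcev_faithful p n r (gT : finGroupType) (G : {group gT})
    (rG : mx_representation 'F_p G n) :
    prime p -> (0 < n <= r)%N -> mx_faithful rG -> solvable G ->
    'O_p(G) = 1 -> rank_le G r ->
  exists N : {group gT}, [/\ N <| G, abelian N & #|G : N| <= malcev_bound r]%N.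
Proof.
move=> p_pr /andP[n_gt0 le_nr] ffG solG Op1 rkG.
have r_gt0 : (0 < r)%N by apply: leq_trans le_nr.
have rr_gt0 : (0 < r ^ r)%N by rewrite expn_gt0 r_gt0.
have le_nn : (n ^ n <= r ^ r)%N.
  apply: (@leq_trans (r ^ n)); first by rewrite leq_exp2r.
  by case: (r) r_gt0 le_nr => // r' _ le_nr; rewrite leq_pexp2l.
have p'nil (M : {group gT}) : M <| G -> nilpotent M -> (p^').-group M.
  move=> nsMG nilM; have := nilpotent_pcoreC p nilM.
  have -> : 'O_p(M) = 1.
    apply/trivgP; rewrite -Op1 pcore_max ?pcore_pgroup //.
    exact: char_normal_trans (pcore_char _ _) nsMG.
  by rewrite dprod1g => <-; apply: pcore_pgroup.
have [N /maxgroupP[/andP[nsNG abN] maxN] _] :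
    {N : {group gT} | [max N | (N <| G) && abelian N] & [1] \subset N}.
  by apply: maxgroup_exists; rewrite normal1 abelian1.
pose C := 'C_G(N)%G.
have nsCG : C <| G by rewrite /normal subsetIl normsI ?normG // norms_cent //
  normal_norm.
have sNC : N \subset C by rewrite subsetI normal_sub.
have [M /maxgroupP[/and4P[nsMG sNM cNM derM] maxM] _] :
    {M : {group gT} | [max M | [&& M <| G, N \subset M, M \subset 'C(N)
                                 & M^`(1) \subset N]] & N \subset M}.
  apply: maxgroup_exists; rewrite nsNG subxx [_ \subset 'C(N)]abN /=.
  by rewrite (derG1P abN) sub1G.
have [sMG nMG] := andP nsMG.
have sMC : M \subset C by rewrite subsetI sMG.
have nsNM : N <| M := normalS sNM sMG nsNG.
have ZM : 'Z(M) = N.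
  apply: (maxN 'Z(M)%G); last by rewrite /= subsetI sNM centsC.
  by rewrite center_abelian (char_normal_trans (center_char M)).
(* Otherwise a layer [L] above [N] inside ['C_G(M)] can be joined to [M]; maximality puts [L] in
   [M], hence in ['Z(M) = N]. *)
have sDN : 'C_G(M) \subset N.
  pose D := 'C_G(M)%G.
  have nsDG : D <| G by rewrite /normal subsetIl normsI ?normG // norms_cent.
  have sND : N \subset D by rewrite subsetI normal_sub // centsC.
  have tiDM : D :&: M \subset N by rewrite -ZM setIAC setSI // subsetIr.
  case: (boolP (D \subset N)) => // not_sDN.
  have [L [nsLG sNL sLD not_sLN derL]] :=
    solvable_normal_layer (solvableS (subsetIl _ _) solG) nsDG nsNG sND not_sDN.
  have nNL := subset_trans (normal_sub nsLG) (normal_norm nsNG).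
  have cLM : L \subset 'C(M) by apply: subset_trans sLD (subsetIr _ _).
  have LM_M : L <*> M = M.
    apply: (maxM (L <*> M)%G); last exact: joing_subr.
    rewrite /= normalY // (subset_trans sNM) ?joing_subr //=.
    rewrite join_subG cNM (subset_trans cLM) ?centS //=.
    have nNM := normal_norm nsNM.
    rewrite der1_min ?join_subG ?nNL // quotientY // abelianY.
    by rewrite !sub_der1_abelian //= centsC quotient_cents.
  case/negP: not_sLN.
  by apply: subset_trans tiDM; rewrite subsetI sLD -LM_M joing_subl.
have nilM : nilpotent M.
  by rewrite -quotient_center_nil ZM abelian_nil // sub_der1_abelian.
have p'M := p'nil M nsMG nilM.
have p'N := pgroupS sNM p'M.
pose b := ((r ^ r) ^ r)%N.
have b_gt0 : (0 < b)%N by rewrite expn_gt0 rr_gt0.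
(* [N] is the centraliser of [M] in [M]. As [M / N] is abelian, the conjugates of [x] under [M] stay
   in the abelian group [N <*> <[x]>]. *)
have leMN : (#|M : N| <= b)%N.
  have [X [leX genX]] := rkG M sMG.
  rewrite -ZM -['Z(M)]/'C_M(M) -[X in 'C(X)]genX.
  apply: index_cent_le => // x Xx; apply: leq_trans le_nn.
  have Mx : x \in M by rewrite -genX mem_gen.
  have sNxM : N <*> <[x]> \subset M by rewrite join_subG sNM cycle_subG.
  apply: (card_class_repr (N := (N <*> <[x]>)%G) p_pr n_gt0 ffG) => //=.
  - exact: subset_trans sNxM sMG.
  - by apply: sub_der1_norm => //; apply: subset_trans derM (joing_subl _ _).
  - by rewrite abelianY abN cycle_abelian cycle_subG (subsetP cNM).
  - exact: pgroupS p'M.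
  - by rewrite -cycle_subG joing_subr.
have leGC : (#|G : C| <= b)%N.
  have [X [leX genX]] := rkG N (normal_sub nsNG).
  rewrite /C /= -{1}genX; apply: index_cent_le => // x Xx;
    apply: leq_trans le_nn.
  apply: (card_class_repr (N := N) p_pr n_gt0 ffG) => //;
    rewrite ?normal_norm ?normal_sub //.
  by rewrite -genX mem_gen.
exists N; split=> //; rewrite -(Lagrange_index (normal_sub nsCG) sNC).
rewrite leq_mul //.
have [X [leX genX]] := rkG M sMG.
have sCM : 'C_C(M) \subset N.
  by apply: subset_trans sDN; rewrite setSI ?subsetIl.
(* Since ['C_C(M)] lies in [N], it is enough to bound the [C]-classes of the generators of [M]. *)
apply: (@leq_trans #|C : 'C_C(M)|); first by rewrite dvdn_leq ?indexgS.
rewrite -[X in 'C(X)]genX; apply: index_cent_le => // [|x Xx].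
  by rewrite muln_gt0 b_gt0 expn_gt0 b_gt0.
have Mx : x \in M by rewrite -genX mem_gen.
apply: leq_trans (@card_class_central_le _ C M N x r _ _ _ _ _ _) _ => //.
- by rewrite (subset_trans (normal_sub nsCG)).
- exact: subsetIr.
- exact: rank_leS (normal_sub nsNG) rkG.
- by rewrite leq_mul // leq_exp2r.
Qed.

(** * Frattini and Fitting subgroups *)

Section Frattini.
Variable gT : finGroupType.
Implicit Types G K M N W : {group gT}.

Lemma sub_Phi_maximal G N :
  N \subset G -> (forall M : {group gT}, maximal M G -> N \subset M) ->
  N \subset 'Phi(G).
Proof.
move=> sNG sNM; apply/bigcapsP=> M; case/predU1P=> [->//|]; exact: sNM.
Qed.

Lemma mul_normal_maximal G N M :
  N <| G -> maximal M G -> ~~ (N \subset M) -> N * M = G.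
Proof.
move=> /andP[sNG nNG] /maxgroupP[prMG maxM] nsNM; have sMG := proper_sub prMG.
rewrite -norm_joinEr ?(subset_trans sMG) //; apply/eqP.
apply: contraNT nsNM => neG;
  rewrite -(maxM (N <*> M)%G) ?joing_subl ?joing_subr //.
by rewrite properEneq neG join_subG sNG.
Qed.

(** If a maximal [M] does not contain ['Phi(N)], then [G = 'Phi(N) * M]. By Dedekind's law [N] is
    generated by ['Phi(N)] and [M :&: N], hence by [M :&: N] alone, a contradiction. *)
Lemma PhiS_normal G N : N <| G -> 'Phi(N) \subset 'Phi(G).
Proof.
move=> nsNG; have nsPG := char_normal_trans (Phi_char N) nsNG.
apply: sub_Phi_maximal (normal_sub nsPG) _ => M maxM.
have [//|nsPM] := boolP ('Phi(N) \subset M).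
have defG := mul_normal_maximal nsPG maxM nsPM.
have defN : 'Phi(N) <*> (M :&: N) = N.
  rewrite norm_joinEr; last first.
    by rewrite (subset_trans (subsetIr _ _)) // normal_norm // Phi_normal.
  by rewrite group_modl ?Phi_sub // defG (setIidPr (normal_sub nsNG)).
have := Phi_nongen defN; rewrite genGid => /setIidPr sNM.
by case/negP: nsPM; apply: subset_trans (Phi_sub N) sNM.
Qed.

(** Let [L] be the preimage of ['F(G / 'Phi(G))] and [P] a Sylow subgroup of [L]. As [P <*> 'Phi(G)]
    is normal in [G], the Frattini argument gives [G = 'Phi(G) <*> 'N_G(P)], so [P] is normal in
    [G]. Hence [L] is nilpotent. *)
Lemma Fitting_quotient_Phi G :
  'Phi(G) \subset 'F(G) /\ 'F(G / 'Phi(G)) = 'F(G) / 'Phi(G).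
Proof.
have nsPG := Phi_normal G.
suffices [L [sPhiL sLF defL]] : exists L : {group gT},
    [/\ 'Phi(G) \subset L, L \subset 'F(G) & 'F(G / 'Phi(G)) = L / 'Phi(G)].
  split; first exact: subset_trans sPhiL sLF.
  apply/eqP; rewrite eqEsubset {1}defL quotientS //= Fitting_max ?quotient_nil
    ?Fitting_nil //.
  exact: quotient_normal (Fitting_normal G).
have [L defL sPhiL nsLG] := inv_quotientN nsPG (Fitting_normal (G / 'Phi(G))).
have nilLq : nilpotent (L / 'Phi(G)) by rewrite -defL Fitting_nil.
exists L; split=> //; apply: (Fitting_max nsLG).
suffices sLF : L \subset 'F(L) by apply: nilpotentS sLF (Fitting_nil L).
have sylF (p : nat) : #|L|`_p %| #|'F(L)|.
  have [P sylP] := Sylow_exists p L; rewrite -(card_Hall sylP) cardSg //.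
  apply: subset_trans (pcore_sub p 'F(L)); rewrite p_core_Fitting.
  apply: pcore_max (pHall_pgroup sylP) _.
  have sPL := pHall_sub sylP; have sPG := subset_trans sPL (normal_sub nsLG).
  have nPhiP := subset_trans sPG (normal_norm nsPG).
  suffices nPG : G \subset 'N(P)
    by rewrite /normal sPL (subset_trans (normal_sub nsLG)).
  have nsPP : P <*> 'Phi(G) <| G.
    rewrite joingC -(quotientYK nPhiP) -[X in _ <| X](quotientGK nsPG) /=
      cosetpre_normal.
    have sylPq := quotient_pHall nPhiP sylP.
    rewrite (nilpotent_Hall_pcore nilLq sylPq).
    exact: char_normal_trans (pcore_char _ _) (quotient_normal _ nsLG).
  have sPPL : P <*> 'Phi(G) \subset L by rewrite join_subG sPL.
  have sylP1 := pHall_subl (joing_subl P 'Phi(G)) sPPL sylP.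
  have sPNP : P \subset 'N_G(P) by rewrite subsetI sPG normG.
  have defG : 'Phi(G) <*> 'N_G(P) = G.
    apply/eqP; rewrite eqEsubset join_subG Phi_sub subsetIl /=.
    rewrite -{1}(Frattini_arg nsPP sylP1) mul_subG ?joing_subr //.
    by rewrite join_subG joing_subl andbT (subset_trans sPNP) ?joing_subr.
  by have := Phi_nongen defG; rewrite genGid => /setIidPl.
suffices: L :==: 'F(L) by rewrite eqEsubset => /andP[].
by rewrite eq_sym eqEcard Fitting_sub dvdn_leq //; apply/dvdn_partP.
Qed.

(* A minimal supplement [S] of [W] is a complement, since [W :&: S] is normal
   and lies in every maximal subgroup. *)
Lemma abelian_normal_complement G W :
    'Phi(G) = 1 -> W <| G -> abelian W ->
  exists2 S : {group gT}, W * S = G & W :&: S = 1.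
Proof.
move=> Phi1 nsWG abW; have [sWG nWG] := andP nsWG.
have [S /mingroupP[/eqP defG minS] _] :
    {S : {group gT} | [min S | W * S == G] & S \subset G}.
  by apply: mingroup_exists; rewrite mulSGid.
exists S => //; apply/trivgP; rewrite -Phi1.
have sSG : S \subset G by rewrite -defG mulG_subr.
have nsUG : W :&: S <| G.
  rewrite /normal subIset ?sWG //= -{1}defG mul_subG //.
    by rewrite (subset_trans _ (cent_sub _)) // (subset_trans abW) // centS //
      subsetIl.
  by rewrite normsI ?normG // (subset_trans sSG).
apply: sub_Phi_maximal (normal_sub nsUG) _ => M maxM.
have [//|nsUM] := boolP (W :&: S \subset M).
have defUM := mul_normal_maximal nsUG maxM nsUM.
suffices /setIidPr sSM : M :&: S = S by rewrite subIset ?sSM ?orbT in nsUM.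
apply: minS; last exact: subsetIr.
rewrite -[X in X * _](mulGSid (subsetIl W S)) -mulgA group_modl ?subsetIr //.
by rewrite defUM (setIidPr sSG) defG.
Qed.

Lemma Fitting_cent_pcore G (p : nat) :
  abelian 'O_p(G) -> 'F(G) \subset 'C('O_p(G)).
Proof.
move=> abP; have := nilpotent_pcoreC p (Fitting_nil G).
rewrite p_core_Fitting => /dprodP[_ defF cPP' _].
by rewrite -[X in pred_of_set X \subset _]defF mul_subG // centsC.
Qed.

Lemma pcore_abelem G (p : nat) : prime p -> 'Phi(G) = 1 -> p.-abelem 'O_p(G).
Proof.
move=> p_pr Phi1; rewrite -trivg_Phi ?pcore_pgroup // -subG1 -Phi1.
exact: PhiS_normal (pcore_normal p G).
Qed.

(* If [Q / K] is a normal [p]-subgroup, the complement of ['C_P(Q)] in [P] has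
   no nontrivial fixed point of [Q], hence is trivial. *)
Lemma pcore_quotient_cent_pcore G K (p : nat) :
    prime p -> 'Phi(G) = 1 -> K :=: 'C_G('O_p(G)) -> 'O_p(G / K) = 1.
Proof.
move=> p_pr Phi1 defK; pose P := 'O_p(G)%G; change (gval K = 'C_G(P)) in defK.
have nsPG : P <| G := pcore_normal p G; have [sPG nPG] := andP nsPG.
have abP : abelian P := abelem_abelian (pcore_abelem p_pr Phi1).
have nsKG : K <| G by rewrite defK /normal subsetIl normsI ?normG // norms_cent.
have [Q defQ sKQ nsQG] := inv_quotientN nsKG (pcore_normal p (G / K)).
have [sQG nQG] := andP nsQG.
have nKQ : Q \subset 'N(K) := subset_trans sQG (normal_norm nsKG).
have nsUG : 'C_P(Q) <| G.
  by rewrite /normal subIset ?sPG //= normsI // norms_cent.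
have abU : abelian 'C_P(Q) := abelianS (subsetIl _ _) abP.
have [S defG tiUS] := abelian_normal_complement Phi1 nsUG abU.
have sSG : S \subset G by rewrite -defG mulG_subr.
pose W := (P :&: S)%G.
have sWP : W \subset P := subsetIl _ _.
(* In [G = 'C_P(Q) * S] the first factor centralises [W], as [P] is abelian, and the second
   normalises it. *)
have nsWG : W <| G.
  rewrite /normal subIset ?sPG //= -{1}defG mul_subG //.
    rewrite (subset_trans _ (cent_sub _)) // (subset_trans (subsetIl _ _)) //.
    exact: subset_trans abP (centS sWP).
  by rewrite normsI ?normG // (subset_trans sSG).
have defP : 'C_P(Q) * W = P.
  by rewrite -[gval W]/(P :&: S) (setIC P S) group_modl ?subsetIl // defG
    (setIidPr sPG).
have cWQ : 'C_W(Q) = 1.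
  by apply/trivgP; rewrite -tiUS /= setIAC.
have [R sylR] := Sylow_exists p Q.
have sRQ := pHall_sub sylR.
have sQKR : Q \subset K * R.
  rewrite -quotientSK //.
  rewrite (pHall_id (quotient_pHall (subset_trans sRQ nKQ) sylR)) //.
  by have := pcore_pgroup p (G / K); rewrite [X in p.-group X]defQ.
(* A nontrivial [W] would meet the centre of the [p]-group [W <*> R]. Since [K] centralises [P] and
   [Q] lies in [K * R], this would give nontrivial fixed points of [Q] in [W]. *)
have W1 : W :=: 1.
  apply/eqP/idPn => ntW.
  have pW : p.-group W := pgroupS sWP (pcore_pgroup p G).
  have nWR : R \subset 'N(W) := subset_trans sRQ
    (subset_trans sQG (normal_norm nsWG)).
  have nilWR : nilpotent (W <*> R).
    apply: (@pgroup_nil _ p); rewrite /= norm_joinEr // pgroupM pW.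
    exact: pHall_pgroup sylR.
  have nsWR : W <| W <*> R by rewrite /normal joing_subl join_subG normG.
  case/eqP: (meet_center_nil nilWR nsWR ntW); apply/trivgP; rewrite -cWQ.
  rewrite subsetI subsetIl /= centsC (subset_trans sQKR) // mul_subG //.
    rewrite defK subIset // orbC centS //.
    exact: subset_trans (subsetIl _ _) sWP.
  rewrite centsC (subset_trans (subsetIr _ _)) //
    (subset_trans (subsetIr _ _)) //.
  exact: centS (joing_subr _ _).
have cPQ : Q \subset 'C(P).
  by rewrite centsC -defP W1 mulg1 subsetIr.
have sQK : Q \subset K by rewrite defK subsetI sQG.
by rewrite defQ; apply/trivgP; rewrite quotient_sub1.
Qed.

End Frattini.

(** * The action of a group on its [p]-cores *)

Lemma cent_pcore_normal (gT : finGroupType) (G : {group gT}) (p : nat) :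
  'C_G('O_p(G)) <| G.
Proof.
by rewrite /normal subsetIl normsI ?normG // norms_cent // normal_norm
  ?pcore_normal.
Qed.

(** [B] is the preimage of the subgroup that [malcev_faithful] gives for [G / 'C_G('O_p(G))] acting
    on ['O_p(G)], a space of dimension at most [r]. *)
Lemma pcore_malcev (gT : finGroupType) (G : {group gT}) (p : nat) r :
    prime p -> 'Phi(G) = 1 -> solvable G -> rank_le G r -> 'O_p(G) != 1 ->
  exists B : {group gT}, [/\ B <| G, 'C_G('O_p(G)) \subset B,
    B^`(1) \subset 'C_G('O_p(G)) & #|G : B| <= malcev_bound r]%N.
Proof.
move=> p_pr Phi1 solG rkG ntP.
have abelP := pcore_abelem p_pr Phi1.
have nPG : G \subset 'N('O_p(G)) := normal_norm (pcore_normal p G).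
pose rG := abelem_repr abelP ntP nPG.
pose K := rker_group rG.
have defK : K :=: 'C_G('O_p(G)) := rker_abelem abelP ntP nPG.
have nsKG : K <| G by rewrite defK cent_pcore_normal.
have dimP : (0 < 'dim 'O_p(G) <= r)%N.
  rewrite /= (dim_abelemE abelP) // -(@leq_exp2l p) ?prime_gt1 // -card_pgroup
    ?pcore_pgroup //.
  apply: card_abelian_le (abelem_abelian abelP) _ (prime_gt0 p_pr) _.
    exact/rkG/pcore_sub.
  by have := abelP; rewrite abelemE // => /andP[].
have [N [nsN abN leN]] := malcev_faithful p_pr dimP (kquo_mx_faithful rG)
  (quotient_sol _ solG) (pcore_quotient_cent_pcore p_pr Phi1 defK)
  (rank_le_quotient nsKG rkG).
have [B defB sKB nsBG] := inv_quotientN nsKG nsN.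
exists B; rewrite -defK; split=> //.
  apply: der1_min; first exact: subset_trans (normal_sub nsBG)
    (normal_norm nsKG).
  by rewrite -defB.
have sGKB : G :&: K \subset B by rewrite subIset // sKB orbT.
by rewrite -(index_quotient_eq sGKB (normal_sub nsBG) (normal_norm nsKG)) -defB.
Qed.

Lemma pcore_abelian_quotient (gT : finGroupType) (G A : {group gT}) (p : nat) :
    prime p -> 'Phi(G) = 1 -> A <| G -> A^`(1) \subset 'C_G('O_p(G)) ->
  (p^').-group (A / 'C_G('O_p(G))) /\ (#|A : 'C_A('O_p(G))| <= #|'O_p(G)|)%N.
Proof.
move=> p_pr Phi1 nsAG derA; have [sAG nAG] := andP nsAG.
(* Stated for any group equal to the centraliser, so that it also applies to the kernel
   [rker_group rG]. *)
have quoA (K : {group gT}) : K :=: 'C_G('O_p(G)) ->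
    abelian (A / K) /\ (p^').-group (A / K).
  move=> defK; have nsKG : K <| G by rewrite defK cent_pcore_normal.
  have abA : abelian (A / K) by apply: sub_der1_abelian; rewrite defK.
  split=> //; have := nilpotent_pcoreC p (abelian_nil abA).
  have -> : 'O_p(A / K) = 1.
    apply/trivgP; rewrite -(pcore_quotient_cent_pcore p_pr Phi1 defK).
    apply: pcore_max (pcore_pgroup _ _) _.
    exact: char_normal_trans (pcore_char _ _) (quotient_normal _ nsAG).
  by rewrite dprod1g => <-; apply: pcore_pgroup.
split; first by have [] := quoA 'C_G('O_p(G))%G (erefl _).
have [P1|ntP] := eqVneq 'O_p(G) 1.
  by rewrite P1 (setIidPl _) ?indexgg ?cards1 // centsC sub1G.
have abelP := pcore_abelem p_pr Phi1.
have nPG : G \subset 'N('O_p(G)) := normal_norm (pcore_normal p G).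
pose rG := abelem_repr abelP ntP nPG.
have defK : rker_group rG :=: 'C_G('O_p(G)) := rker_abelem abelP ntP nPG.
have [abAK p'AK] := quoA _ defK.
have sAKG : A / rker_group rG \subset G / rker_group rG by apply: quotientS.
have cardA : #|A / rker_group rG| = #|A : 'C_A('O_p(G))|.
  rewrite card_quotient.
    by rewrite -indexgI /= rker_abelem setIA (setIidPl sAG).
  by rewrite /= rker_abelem (subset_trans sAG) ?normal_norm ?cent_pcore_normal.
have := card_abelian_repr p_pr (subg_mx_faithful sAKG (kquo_mx_faithful rG))
  abAK p'AK.
by rewrite [X in (X <= _)%N]cardA (dim_abelemE abelP) // -card_pgroup
  ?pcore_pgroup.
Qed.

(** * Sections of affine cyclic type *)

Lemma affine_cyclic_type_isog (aT rT : finGroupType) (X : {group aT})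
    (Y : {group rT}) c :
  X \isog Y -> affine_cyclic_type X c -> affine_cyclic_type Y c.
Proof.
case/isogP=> f injf <-
  [p [q [E [C [[p_pr abE defX] [q_pr qC cycC] [C1 p'C cardC]]]]]].
have [sEX sCX] : E \subset X /\ C \subset X
  by case/sdprod_context: defX => /andP[].
exists p, q, (f @* E)%G, (f @* C)%G; split; [split|split| | |] => //.
- by rewrite morphim_abelem.
- exact: injm_sdprod defX.
- exact: morphim_pgroup.
- exact: morphim_cyclic.
- by rewrite /= -injm_subcent // C1 morphim1.
- by rewrite card_injm.
- by rewrite card_injm.
Qed.

Lemma has_aff_section_gt_quotient (gT : finGroupType) (G N : {group gT}) T :
  N <| G -> has_aff_section_gt (G / N) T -> has_aff_section_gt G T.
Proof.
move=> nsNG [Hq [Kq [sHG nsKH [c [ltTc affc]]]]].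
have [H /group_inj defH sNH sHG1] := inv_quotientS nsNG sHG.
have nsNH : N <| H := normalS sNH sHG1 nsNG.
rewrite {}defH in nsKH affc *.
have [K /group_inj defK sNK nsKH1] := inv_quotientN nsNH nsKH.
rewrite {}defK in affc.
exists H, K; split=> //; exists c; split=> //.
exact: affine_cyclic_type_isog (third_isog sNK nsNH nsKH1) affc.
Qed.

(** The section is [P <*> <[y]>] modulo ['C_<[y]>(P)]. *)
Lemma affine_section (gT : finGroupType) (G P : {group gT}) (p q : nat) y T :
    prime p -> prime q -> q != p -> p.-abelem P -> P <| G -> y \in G ->
    q.-elt y -> (T < #|<[y]> : 'C_<[y]>(P)|)%N ->
  has_aff_section_gt G T.
Proof.
move=> p_pr q_pr neqp abelP nsPG Gy qy ltT.
have [sPG nPG] := andP nsPG.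
pose C := <[y]>%G; pose Z := 'C_C(P)%G.
have sCG : C \subset G by rewrite cycle_subG.
have nPC : C \subset 'N(P) := subset_trans sCG nPG.
have nsZC : Z <| C by rewrite -sub_abelian_normal ?cycle_abelian ?subsetIl.
have nZP : P \subset 'N(Z) by rewrite cents_norm // centsC subsetIr.
have nsZH : Z <| P <*> C.
  by rewrite /normal join_subG nZP normal_norm // (subset_trans (subsetIl _ _))
    ?joing_subr.
have coPC (A B : {group coset_of Z}) : p.-group A -> q.-group B -> A :&: B = 1.
  move=> pA qB; apply: coprime_TIg; apply: pnat_coprime pA _.
  by apply: sub_in_pnat qB => r _ /eqnP->; rewrite !inE.
have tiPZ : P :&: Z = 1.
  apply: coprime_TIg; apply: pnat_coprime (abelem_pgroup abelP) _.
  apply: sub_in_pnat (pgroupS (subsetIl _ _) qy) => r _ /eqnP->.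
  by rewrite !inE.
exists (P <*> C)%G, Z; split=> //; first by rewrite join_subG sPG.
exists #|C : Z|; split=> //.
have qCZ : q.-group (C / Z) by apply: quotient_pgroup.
exists p, q, (P / Z)%G, (C / Z)%G; split; [split|split| | |] => //.
- exact: quotient_abelem.
- rewrite sdprodEY ?quotient_norms
  ?(coPC _ _ (quotient_pgroup Z (abelem_pgroup abelP)) qCZ) //.
  by rewrite quotientY // (normal_norm nsZC).
- by rewrite quotient_cyclic ?cycle_cyclic.
(* Faithfulness: if [D] centralises [P] modulo [Z], then [[~: D, P]] lies in [P :&: Z = 1]. *)
- have sDC : 'C_(C / Z)(P / Z) \subset C / Z by apply: subsetIl.
  have [D defD sZD sDC1] := inv_quotientS nsZC sDC.
  have nZD : D \subset 'N(Z) := subset_trans sDC1 (normal_norm nsZC).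
  apply/eqP; rewrite -subG1 /= in defD *;
    rewrite defD quotient_sub1 // subsetI sDC1 /=.
  have sDPZ : [~: D, P] \subset Z by rewrite -quotient_cents2 // -defD subsetIr.
  apply/commG1P/trivgP; rewrite -tiPZ subsetI sDPZ andbT.
  by rewrite commg_subr (subset_trans sDC1).
- rewrite -p'natE //; apply: sub_in_pnat qCZ => r _ /eqnP->.
  by rewrite !inE.
- by rewrite card_quotient ?normal_norm.
Qed.

(** By [affine_section], every [q]-part of the order of [x] modulo ['C_G('O_p(G))] is at most [T],
    so divides the factorial; hence so does the order. *)
Lemma expg_fact_cent_pcore (gT : finGroupType) (G A : {group gT}) (p : nat)
    T x :
    prime p -> 'Phi(G) = 1 -> A <| G -> A^`(1) \subset 'C_G('O_p(G)) ->
    ~ has_aff_section_gt G T -> x \in A ->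
  x ^+ T`! \in 'C('O_p(G)).
Proof.
move=> p_pr Phi1 nsAG derA noT Ax.
have [p'A _] := pcore_abelian_quotient p_pr Phi1 nsAG derA.
have Gx := subsetP (normal_sub nsAG) x Ax.
pose K := 'C_G('O_p(G))%G; have nsKG : K <| G := cent_pcore_normal G p.
have nKG := normal_norm nsKG; have nKx := subsetP nKG x Gx.
suffices: #[coset K x] %| T`!.
  rewrite order_dvdn => /eqP xT.
  have : x ^+ T`! \in K by apply: coset_idr; rewrite ?groupX ?morphX.
  by case/setIP.
apply/dvdn_partP=> // q; rewrite mem_primes => /and3P[q_pr _ dvq].
have neqp : q != p.
  by have /(pnatP _ (order_gt0 _))/(_ q q_pr dvq) := mem_p_elt p'A
    (mem_quotient K Ax).
rewrite -order_constt dvdn_fact // order_gt0 /= leqNgt.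
apply/negP=> ltT; case: noT.
have yG : x.`_q \in G by apply: groupX.
apply: (affine_section p_pr q_pr neqp (pcore_abelem p_pr Phi1)
  (pcore_normal p G) yG).
  exact: p_elt_constt.
move: ltT; rewrite -morph_constt // orderE -quotient_cycle ?(subsetP nKG) //.
rewrite card_quotient ?cycle_subG ?(subsetP nKG) //.
have syG : <[x.`_q]> \subset G by rewrite cycle_subG.
by rewrite -indexgI /= setIA (setIidPl syG).
Qed.

(** * The abelian normal subgroup *)

Lemma index_setI_le (gT : finGroupType) (A X Y : {group gT}) :
  (#|A : X :&: Y| <= #|A : X| * #|A : Y|)%N.
Proof.
rewrite -(indexgI A (X :&: Y)) /= setIA -(indexgI A X).
rewrite -(Lagrange_index (subsetIl A X) (subsetIl (A :&: X) Y)) leq_mul //.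
by rewrite indexgI subset_leq_card // imsetS ?subsetIl.
Qed.

Lemma exists_inter_index_le (gT : finGroupType) (A : {group gT}) (s : seq nat)
    (X : nat -> {group gT}) :
  exists D : {group gT}, [/\ D \subset A, forall p, p \in s -> D \subset X p
    & #|A : D| <= \prod_(p <- s) #|A : X p|]%N.
Proof.
elim: s => [|p s [D [sDA sDX leD]]]; first by exists A; rewrite big_nil indexgg.
exists (X p :&: D)%G; split=> [|q|]; first by rewrite subIset ?sDA ?orbT.
  by case/predU1P=> [->|/sDX sDq]; rewrite subIset ?subxx ?sDq ?orbT.
by rewrite big_cons (leq_trans (index_setI_le A _ _)) ?leq_mul.
Qed.

(** Otherwise there is a layer [L] inside [C], with derived group in [Z]. As [L] centralises
    ['F(G)], [Z] is central in [L]; so [L] is nilpotent and lies in ['F(G)], a contradiction. *)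
Lemma cent_sub_Fitting (gT : finGroupType) (G : {group gT}) :
  solvable G -> 'C_G('F(G)) \subset 'F(G).
Proof.
move=> solG; pose C := 'C_G('F(G))%G; pose Z := (C :&: 'F(G))%G.
have nsFG := Fitting_normal G.
have nsCG : C <| G by rewrite /normal subsetIl normsI ?normG // norms_cent //
  normal_norm.
have nsZG : Z <| G by rewrite normalI.
have [//|] := boolP (C \subset 'F(G));
  rewrite -[C \subset _]andTb -(subxx C) -subsetI.
case/(solvable_normal_layer (solvableS (subsetIl _ _) solG) nsCG nsZG
  (subsetIl _ _)).
move=> L [nsLG sZL sLC not_sLZ derL]; case/negP: not_sLZ.
rewrite subsetI sLC Fitting_max // -(@quotient_center_nil _ L).
apply/abelian_nil/sub_der1_abelian/(subset_trans derL).
rewrite subsetI sZL centsC (subset_trans sLC) //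
  (subset_trans (subsetIr _ _)) //.
exact: centS (subsetIr _ _).
Qed.

Lemma sub_Fitting_cent_pcore (gT : finGroupType) (G Y : {group gT}) :
    solvable G -> Y \subset G ->
    (forall p : nat, prime p -> p \in \pi('F(G)) -> Y \subset 'C('O_p(G))) ->
  Y \subset 'F(G).
Proof.
move=> solG sYG cYP; apply: subset_trans (cent_sub_Fitting solG).
rewrite subsetI sYG centsC FittingEgen gen_subG; apply/bigcupsP=> p pi_p.
rewrite centsC; have [p_pi|] := boolP ((p : nat) \in \pi('F(G))).
  by apply: cYP => //; move: pi_p; rewrite mem_primes => /andP[].
rewrite -p'groupEpi => p'F; suffices -> : 'O_p(G) = 1 by rewrite cents1.
rewrite -p_core_Fitting -(setIidPl (pcore_sub p 'F(G))).
exact: coprime_TIg (pnat_coprime (pcore_pgroup p 'F(G)) p'F).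
Qed.

Definition index_bound r := (((malcev_bound r)`! ^ r) ^ malcev_bound r)%N.

Lemma trivial_Phi_abelian_by_bounded (gT : finGroupType) (G : {group gT}) r :
    solvable G -> 'Phi(G) = 1 -> rank_le G r ->
  exists A : {group gT},
    [/\ A <| G, 'F(G) \subset A, A^`(1) \subset 'F(G)
      & [/\ #|A : 'F(G)| <= #|'F(G)|, #|G : A| <= index_bound r
      & forall T, ~ has_aff_section_gt G T -> forall x, x \in A ->
        x ^+ T`! \in 'F(G)]]%N.
Proof.
move=> solG Phi1 rkG; set m := malcev_bound r.
pose Pr (B : {group gT}) := [&& B <| G, 'F(G) \subset B & #|G : B| <= m]%N.
pose I := [group of \bigcap_(B : {group gT} | Pr B) B]; pose A := (G :&: I)%G.
have nsAG : A <| G.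
  rewrite /normal subsetIl normsI ?normG //=.
  by apply: norms_bigcap; apply/bigcapsP=> B /and3P[/normal_norm].
have sFA : 'F(G) \subset A.
  by rewrite subsetI Fitting_sub; apply/bigcapsP=> B /and3P[].
have sFC (p : nat) : prime p -> 'F(G) \subset 'C_G('O_p(G)).
  move=> p_pr; rewrite subsetI Fitting_sub Fitting_cent_pcore //.
  exact: abelem_abelian (pcore_abelem p_pr Phi1).
have derA (p : nat) : prime p -> A^`(1) \subset 'C_G('O_p(G)).
  move=> p_pr; have [P1|ntP] := eqVneq 'O_p(G) 1.
    by rewrite P1 subsetI (subset_trans (der_sub 1 A)) ?subsetIl ?cents1.
  (* [B] contains ['C_G('O_p(G))], hence ['F(G)], so it is one of the subgroups intersected in
     [I]. *)
  have [B [nsB sCB derB leB]] := pcore_malcev p_pr Phi1 solG rkG ntP.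
  apply: subset_trans derB; apply: dergS; apply: subset_trans (subsetIr _ _) _.
  by apply: bigcap_inf; rewrite /Pr nsB leB (subset_trans (sFC p p_pr)).
exists A; split=> //; last split.
- apply: sub_Fitting_cent_pcore => // [|p p_pr _].
    by rewrite (subset_trans (der_sub 1 A)) ?subsetIl.
  by apply: subset_trans (derA p p_pr) (subsetIr _ _).
- pose X (p : nat) := 'C('O_p(G))%G; pose n := #|'F(G)|.
  (* This is the range of the product defining [partn], so the indices are compared with the
     [p]-parts of [n] factor by factor; at nonprime [p] both are 1. *)
  pose s := index_iota 0 n.+1.
  have [D [sDA sDX leD]] := exists_inter_index_le A s X.
  have sDF : D \subset 'F(G).
    apply: sub_Fitting_cent_pcore => // [|p p_pr].
      exact: subset_trans sDA (normal_sub nsAG).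
    rewrite mem_primes => /and3P[_ n_gt0 dv_p]; apply: (sDX p).
    by rewrite mem_index_iota ltnS; apply: dvdn_leq dv_p.
  apply: leq_trans (dvdn_leq (indexg_gt0 _ _) (indexgS A sDF))
    (leq_trans leD _).
  rewrite -[X in (_ <= X)%N](partnT (cardG_gt0 'F(G))) /partn leq_prod //
    => p _.
  rewrite -p_part -(card_Hall (nilpotent_pcore_Hall p (Fitting_nil G))) /=.
  rewrite p_core_Fitting -indexgI; have [p_pr|np] := boolP (prime p).
    by have [_] := pcore_abelian_quotient p_pr Phi1 nsAG (derA p p_pr).
  have [-> |/(pgroup_pdiv (pcore_pgroup p G))[p_pr]] := eqVneq 'O_p(G) 1.
    by rewrite (setIidPl _) ?indexgg ?cards1 // centsC sub1G.
  by rewrite p_pr in np.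
- rewrite indexgI; apply: (@index_bigcap_le r m _ G Pr solG rkG) => B.
  by case/and3P.
move=> T noT x Ax.
rewrite -cycle_subG; apply: sub_Fitting_cent_pcore => // [|p p_pr _].
  by rewrite cycle_subG groupX // (subsetP (normal_sub nsAG)).
rewrite cycle_subG; exact: expg_fact_cent_pcore (derA p p_pr) noT Ax.
Qed.

Theorem theorem3p9 :
  forall r : nat, (1 <= r)%N ->
  exists g : nat,
  forall (gT : finGroupType) (G : {group gT}),
    solvable G -> has_rank G r ->
    exists A : {group coset_of 'F(G)},
      [/\ A <| G / 'F(G), abelian A,
          (#|A| <= #|'F(G) / 'Phi(G)|)%N,
          (#|G / 'F(G) : A| <= g)%N &
          forall T : nat, (0 < T)%N -> ~ has_aff_section_gt G T ->
            (#|A| <= T`! ^ r)%N].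
Proof.
move=> r _; exists (index_bound r) => gT G solG [rkG _].
have nsPG := Phi_normal G; have nsFG := Fitting_normal G.
have [sPF defF] := Fitting_quotient_Phi G.
(* The subgroup found in [G / 'Phi(G)] is pulled back to [A]. The Fitting subgroup there is
   ['F(G) / 'Phi(G)], whence the bound on [A / 'F(G)]. *)
have := trivial_Phi_abelian_by_bounded (quotient_sol _ solG) (Phi_quotient_id G)
  (rank_le_quotient nsPG rkG).
case=> Aq [nsAq sFAq derAq [leAF leGA expA]].
have [A /group_inj defA sPA nsAG] := inv_quotientN nsPG nsAq.
rewrite {Aq}defA defF in nsAq sFAq derAq leAF leGA expA *.
have nPA := subset_trans (normal_sub nsAG) (normal_norm nsPG).
have nPF := subset_trans (normal_sub nsFG) (normal_norm nsPG).
have sFA : 'F(G) \subset A by rewrite -(quotientSGK nPF sPA).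
have nFA := subset_trans (normal_sub nsAG) (normal_norm nsFG).
have nPA' : A^`(1) \subset 'N('Phi(G)) by apply: subset_trans (der_sub 1 A) nPA.
have derA : A^`(1) \subset 'F(G).
  by rewrite -(quotientSGK nPA' sPF) quotient_der.
have abA : abelian (A / 'F(G)) by apply: sub_der1_abelian.
exists (A / 'F(G))%G; split=> //.
- exact: quotient_normal.
- have sAPF : A :&: 'Phi(G) \subset 'F(G) by rewrite subIset // sPF orbT.
  by rewrite card_quotient // -(index_quotient_eq sAPF sFA nPA).
- have sGFA : G :&: 'F(G) \subset A by rewrite subIset // sFA orbT.
  have sGPA : G :&: 'Phi(G) \subset A by rewrite subIset // sPA orbT.
  rewrite (index_quotient_eq sGFA (normal_sub nsAG) (normal_norm nsFG)).
  by rewrite -(index_quotient_eq sGPA (normal_sub nsAG) (normal_norm nsPG)).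
(* Affine sections of [G / 'Phi(G)] are sections of [G], so the exponent of [A / 'F(G)] divides the
   factorial of [T]. *)
move=> T _ noT; apply: card_abelian_le => //.
- apply: (rank_le_quotient nsFG rkG); apply: quotientS; exact: normal_sub.
- exact: fact_gt0.
apply/exponentP=> _ /morphimP[x nFx Ax ->]; rewrite -morphX //=;
  apply: coset_id.
have noTq : ~ has_aff_section_gt (G / 'Phi(G)) T.
  by move/(has_aff_section_gt_quotient nsPG).
have nPx := subsetP nPA x Ax.
have nPxT : <[x ^+ T`!]> \subset 'N('Phi(G)) by rewrite cycle_subG groupX.
rewrite -cycle_subG -(quotientSGK nPxT sPF) quotient_cycle ?groupX //
  cycle_subG.
by rewrite morphX //= expA ?mem_quotient.
Qed.
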